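(* Let $X$ be a locally compact Polish space, with any compatible metric. Then $E_X^{CC} \leq_B (\mathbb{R}/\ell_\infty)^{\mathbb{N}}$.
   Context: A continuum is a nonempty compact connected metrizable space (single points are continua). For a metric space $X$, the chain continuum-connection relation $E_X^{CC}$ on $X$ is: $x\,E_X^{CC}\,y$ iff for every $\varepsilon>0$ there are $n\in\mathbb{N}$ and continua $K_0,\dots,K_n\subset X$ of diameter $<\varepsilon$ such that $x\in K_0$, $y\in K_n$ and $K_i\cap K_{i+1}\neq\emptyset$ for $0\le i<n$. $\mathbb{R}/\ell_\infty$ denotes the equivalence relation on $\mathbb{R}^{\mathbb{N}}$ in which $x,y$ are related iff $x-y\in\ell_\infty$ (i.e. $x-y$ is bounded). For an equivalence relation $F$ on $Y$, $F^{\mathbb{N}}$ is the equivalence relation on $Y^{\mathbb{N}}$ in which $(x_n)$ and $(y_n)$ are related iff $x_nFy_n$ for all $n$. For equivalence relations $E,F$ on standard Borel spaces $X,Y$, $E\leq_B F$ means that there is a Borel map $f:X\to Y$ with $xEy\iff f(x)Ff(y)$ for all $x,y\in X$. *)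

(* Defs.v *)
From HB Require Import structures.
From mathcomp Require Import all_boot all_order all_algebra.
From mathcomp Require Import all_classical all_reals all_analysis.

Set Implicit Arguments.
Unset Strict Implicit.
Unset Printing Implicit Defensive.

Import Order.TTheory GRing.Theory Num.Theory.
Import numFieldTopology.Exports numFieldNormedType.Exports.

Local Open Scope classical_set_scope.
Local Open Scope ring_scope.

Definition separable (X : topologicalType) :=
  exists2 D : set X, countable D & dense D.

Definition is_metric (R : realType) (X : Type) (d : X -> X -> R) :=
  [/\ forall x, d x x = 0,
      forall x y, d x y = 0 -> x = y,
      forall x y, d x y = d y x &
      forall x y z, d x z <= d x y + d y z].

Definition compatible_metric (R : realType) (X : topologicalType)
    (d : X -> X -> R) :=
  is_metric d /\
  forall x : X, nbhs x = nbhs_ball_ (fun y e => [set z | d y z < e]) x.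

Definition complete_metric (R : realType) (X : topologicalType)
    (d : X -> X -> R) :=
  forall u : nat -> X,
    (forall e : R, 0 < e -> exists N : nat, forall m n : nat,
       (N <= m)%N -> (N <= n)%N -> d (u m) (u n) < e) ->
    exists l : X, u @ \oo --> l.

(* The complete metric [d] is only required to exist: it need not be the
   distance carried by [X] when [X] is a [metricType]. *)
Definition polish (R : realType) (X : topologicalType) :=
  separable X /\
  exists d : X -> X -> R, compatible_metric d /\ complete_metric d.

(* [connected] and [compact] hold of the empty set, hence the first clause. *)
Definition continuum (X : topologicalType) (K : set X) :=
  [/\ K !=set0, compact K & connected K].

Definition diameter (R : realType) (X : metricType R) (A : set X) : \bar R :=
  ereal_sup [set (mdist p.1 p.2)%:E | p in A `*` A].

Definition chain_continuum_connected (R : realType) (X : metricType R)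
    (x y : X) :=
  forall e : R, 0 < e ->
  exists (n : nat) (K : nat -> set X),
    [/\ forall i, (i <= n)%N -> continuum (K i) /\ (diameter (K i) < e%:E)%E,
        K 0%N x, K n y &
        forall i, (i < n)%N -> K i `&` K i.+1 !=set0].

Definition ell_infty (R : realType) : set (nat -> R) :=
  [set u | bounded_fun u].

Definition R_mod_ell_infty (R : realType) (x y : {ptws nat -> R}) : Prop :=
  ell_infty (fun n => x n - y n).

Definition rel_power (Y : Type) (F : Y -> Y -> Prop)
    (x y : {ptws nat -> Y}) : Prop :=
  forall n, F (x n) (y n).

Definition borel_set (X : topologicalType) : set (set X) :=
  <<s [set U : set X | open U] >>.

Definition borel_map (X Y : topologicalType) (f : X -> Y) :=
  forall B : set Y, borel_set B -> borel_set (f @^-1` B).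

Definition borel_reducible (X Y : topologicalType)
    (E : X -> X -> Prop) (F : Y -> Y -> Prop) :=
  exists2 f : X -> Y, borel_map f & forall x y, E x y <-> F (f x) (f y).

(* Main.v *)
(* Fix e > 0. Finite unions of members of a countable closed base give countably
   many compact sets A_0, A_1, ... of diameter < e such that every compact set of
   diameter < e lies in one of them. Hence x and y are joined by a chain of continua
   of diameter < e iff they are related by the equivalence relation generated by the
   relations of lying in the same component of A_i. In a compact set components and
   quasi-components agree, so the union of the components of A_i that meet a closed
   set is closed. Consequently the set of points that reach a closed set in n steps,
   using only A_0, ..., A_(n-1), is closed. As in Rosendal's argument for K_sigma
   equivalence relations, the Kuratowski embedding sending x to the numbers of steps
   from x to the basic closed sets, truncated at every N, reduces the relation to
   R/l_infinity; letting e run through the 1/(m+1) gives the countable power. *)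

Require Import Defs.
From mathcomp Require Import all_boot all_order all_algebra.
From mathcomp Require Import all_classical all_reals all_analysis.
From mathcomp Require Import lra zify.
Set Implicit Arguments.
Unset Strict Implicit.
Unset Printing Implicit Defensive.
Import Order.TTheory GRing.Theory Num.Theory.
Import numFieldTopology.Exports numFieldNormedType.Exports.
Local Open Scope classical_set_scope.
Local Open Scope ring_scope.

(** * Components of compact sets *)

Section quasi_component.
Context {R : realType} {T : topologicalType}.
Implicit Types (A B D : set T) (x y : T).

(** For closed [A] these are the relatively clopen subsets of [A], expressed by closed sets of the
    ambient space. *)
Definition clopen_in A D := [/\ D `<=` A, closed D & closed (A `\` D)].

Definition quasi_component A x := \bigcap_(D in [set D | clopen_in A D /\ D x]) D.

Lemma clopen_inI A D D' : clopen_in A D -> clopen_in A D' -> clopen_in A (D `&` D').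
Proof.
move=> [DA cD cAD] [_ cD' cAD']; split; first by move=> x [/DA].
  exact: closedI.
by rewrite setDIr; exact: closedU.
Qed.

Lemma clopen_in_component A D x : clopen_in A D -> D x ->
  connected_component A x `<=` D.
Proof.
move=> [DA cD cAD] Dx y [C [Cx CA Cc Cy]].
have sD : separated D (A `\` D).
  rewrite /separated -(closure_id _).1// -(closure_id _).1//.
  by rewrite setDE setICA setICr setI0.
have [|/(_ _ Cy)//|/(_ _ Cx)[]//] := connected_subset sD _ Cc.
by move=> z /CA Az; rewrite setUDr setDv setD0; right.
Qed.

(** If no such [D] existed, the parts outside [V] of the relatively clopen sets around [x] would
    generate a proper filter on the compact set [A]. A cluster point would lie in the
    quasi-component, hence in [V], yet the filter contains a set disjoint from [V]. *)
Lemma quasi_component_nbhs A x (V : set T) : closed A -> compact A -> A x ->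
  open V -> quasi_component A x `<=` V ->
  exists D, [/\ clopen_in A D, D x & D `<=` V].
Proof.
move=> clA cA Ax oV QV; apply: contrapT => noD.
have cAA : clopen_in A A by split=> //; rewrite setDv; exact: closed0.
pose S := [set D | clopen_in A D /\ D x].
pose F := filter_from S (fun D => D `\` V).
have PF : ProperFilter F.
  apply: filter_from_proper.
    apply: filter_from_filter; first by exists A.
    move=> D D' [sD Dx] [sD' D'x]; exists (D `&` D').
      by split; [exact: clopen_inI|split].
    by rewrite setIDAC setDE setIAC => z [[Dz D'z] Vz].
  move=> D [sD Dx]; apply/set0P/eqP => DV.
  by apply: noD; exists D; split=> //; rewrite -setD_eq0.
have [p [Ap clp]] : A `&` cluster F !=set0.
  by apply: cA; exists A => // z [].
have Qp : quasi_component A x p.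
  move=> D [sD Dx]; case: (sD) => _ cD _; apply: cD => W Wp.
  have [|z [[Dz _] Wz]] := clp (D `\` V) W _ Wp; first by exists D.
  by exists z.
have [|z [[_ nVz] Vz]//] := clp (A `\` V) V _ (open_nbhs_nbhs (conj oV (QV _ Qp))).
by exists A.
Qed.

Lemma quasi_component_closed A x : closed (quasi_component A x).
Proof. by apply: closed_bigI => D [[]]. Qed.

Lemma quasi_component_refl A x : quasi_component A x x.
Proof. by move=> D []. Qed.

(** By normality, two closed pieces splitting the quasi-component have disjoint open neighbourhoods.
    A relatively clopen [D] inside their union is cut by one of them to a relatively clopen set that
    contains [x] and misses the other piece. *)
Lemma quasi_component_connected A x : normal_space T -> closed A -> compact A ->
  A x -> connected (quasi_component A x).
Proof.
move=> nT clA cA Ax; apply/connectedP => E [E0 EQ sE].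
wlog E0x : E E0 EQ sE / E false x.
  move=> wl; have := @quasi_component_refl A x; rewrite {1}EQ => -[E0x|E1x].
    exact: (wl E).
  apply: (wl (E \o negb)) => //; first by case => /=.
    by rewrite EQ setUC.
  by rewrite separatedC.
have clE b : closed (E b).
  rewrite closure_id eqEsubset; split; first exact: subset_closure.
  move=> z clz; have : quasi_component A x z.
    apply: quasi_component_closed; apply: closureS clz; rewrite EQ.
    by case: (b); [right|left].
  rewrite EQ; case: sE => s1 s2; case: b clz => clz [] // Ez; exfalso.
    by move: s2; apply/eqP/set0P; exists z.
  by move: s1; apply/eqP/set0P; exists z.
have [U0 [U1 [oU0 oU1 EU0 EU1 U01]]] := (@normal_openP R T).1 nT _ _ (clE false)
  (clE true) (separated_disjoint sE).
have [|D [[DA cD cAD] Dx DU]] :=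
    @quasi_component_nbhs A x (U0 `|` U1) clA cA Ax (openU oU0 oU1).
  by rewrite EQ; exact: setUSS.
have U1N : forall z, U1 z -> ~ U0 z.
  by move=> z U1z U0z; move: U01; apply/eqP/set0P; exists z.
(* The right-hand form is visibly closed; the left-hand form has visibly closed complement in
   [A]. *)
have DU0 : D `&` U0 = D `\` U1.
  apply/seteqP; split=> z [Dz Uz]; split=> //; first by move=> /U1N.
  by case: (DU _ Dz).
have [z Ez] := E0 true.
have : (D `&` U0) z.
  have : quasi_component A x z by rewrite EQ; right.
  apply; split; last by split=> //; exact: EU0.
  split; first by move=> w [/DA].
    by rewrite DU0; apply: closedI => //; exact: open_closedC.
  by rewrite setDIr; apply: closedU => //; apply: closedI => //; exact: open_closedC.
by move=> [_]; apply: U1N; exact: EU1.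
Qed.

(** Let [y] be a limit point. If its quasi-component misses [B], so does a relatively clopen [D]
    around [y]; components of points of [D] stay in [D], a contradiction. Otherwise the
    quasi-component, being connected, links [y] to a point of [B]. *)
Lemma closed_component_saturation A B : normal_space T -> closed A -> compact A ->
  closed B -> closed [set x | exists2 b, B b & connected_component A x b].
Proof.
move=> nT clA cA clB y cly.
have SA : [set x | exists2 b, B b & connected_component A x b] `<=` A.
  by move=> z [b _] /connected_component_sym/connected_component_sub.
have Ay : A y by apply: clA; exact: closureS cly.
have [QB|] := pselect (quasi_component A y `<=` ~` B).
  have [D [[DA cD cAD] Dy DB]] :=
    quasi_component_nbhs clA cA Ay (closed_openC clB) QB.
  have [|z [[b Bb zb] nADz]] := cly (~` (A `\` D)).
    by apply: open_nbhs_nbhs; split; [exact: closed_openC|case].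
  have Dz : D z.
    by apply: contrapT => nDz; apply: nADz; split=> //; apply: SA; exists b.
  by case: (DB b) => //; apply: (@clopen_in_component A D z).
move=> /existsNP[b /not_implyP[Qb /contrapT Bb]]; exists b => //.
exists (quasi_component A y) => //; split; first exact: quasi_component_refl.
  by move=> z; apply; split=> //; split=> //; rewrite setDv; exact: closed0.
exact: quasi_component_connected.
Qed.

End quasi_component.

(** * Closed reachability *)

Definition closed_base (T : topologicalType) (C : nat -> set T) :=
  (forall n, closed (C n)) /\
  forall (x : T) U, nbhs x U -> exists n, nbhs x (C n) /\ C n `<=` U.

(** The default value for non-codes is harmless: only surjectivity is used. *)
Definition decode_pair (j : nat) : nat * nat := odflt (0%N, 0%N) (unpickle j).

Lemma decode_pairK p : decode_pair (pickle p) = p.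
Proof. by rewrite /decode_pair pickleK. Qed.

Section reach.
Context {X : Type} (Q : nat -> X -> X -> Prop).
Implicit Types (B C : set X).

Definition spread n B :=
  B `|` \bigcup_(i in `I_n) [set x | exists2 b, B b & Q i x b].

(** One [n] bounds both the number of steps and the indices of the relations, so each stage is built
    from finite unions and stays closed. *)
Definition reach n B := iter n (spread n) B.

Lemma iter_spreadS k n n' B B' : (n <= n')%N -> B `<=` B' ->
  iter k (spread n) B `<=` iter k (spread n') B'.
Proof.
move=> nn' BB'; elim: k => //= k IH x [/IH|[i /= ni [b /IH ? ?]]]; first by left.
by right; exists i; [exact: leq_trans nn'|exists b].
Qed.

Lemma reach_comp p n B : reach p (reach n B) `<=` reach (p + n) B.
Proof.
rewrite /reach iterD => x xB.
by apply: iter_spreadS (leq_addr _ _) _ _ xB; apply: iter_spreadS (leq_addl _ _) _.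
Qed.

Lemma iter_spread_sub k n B : B `<=` iter k (spread n) B.
Proof. by elim: k => //= k IH x /IH; left. Qed.

Lemma reach_sub n B : B `<=` reach n B.
Proof. exact: iter_spread_sub. Qed.

(** A step along [Q i] costs [i.+1], the first stage at which [Q i] is available. *)
Lemma reach_step i n B x b : Q i x b -> reach n B b -> reach (i.+1 + n) B x.
Proof.
move=> Qxb nb; apply: reach_comp; right; exists i => //=; exists b => //.
exact: iter_spread_sub nb.
Qed.

Lemma reach_mono n n' B : (n <= n')%N -> reach n B `<=` reach n' B.
Proof.
by move=> /subnKC <- x xB; rewrite addnC; apply: reach_comp; apply: reach_sub.
Qed.

Hypothesis Qsym : forall i x y, Q i x y -> Q i y x.

(** Chains are reversed: the step next to [C] is moved over to [C], one at a time, with the bound on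
    indices kept fixed. *)
Lemma reach_adj n B C : reach n B `&` C !=set0 -> B `&` reach n C !=set0.
Proof.
rewrite /reach; elim: {1 3}n B C => // k IH B C.
rewrite iterS iterSr => -[x [[xB|[i ni [b bB Qxb]]] Cx]]; apply: IH.
  by exists x; split=> //; left.
by exists b; split=> //; right; exists i => //; exists x => //; exact: Qsym.
Qed.

Lemma reach1_sym n x y : reach n [set y] x -> reach n [set x] y.
Proof. by move=> xy; have [|_ [-> ]//] := @reach_adj n [set y] [set x]; exists x. Qed.

End reach.

Lemma closed_reach (T : topologicalType) (Q : nat -> T -> T -> Prop) n (B : set T) :
  (forall i C, closed C -> closed [set x | exists2 b, C b & Q i x b]) ->
  closed B -> closed (reach Q n B).
Proof.
move=> cQ cB; rewrite /reach; elim: {1}n => //= k IH.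
by apply: closedU => //; apply: closed_bigcup => // i _; exact: cQ.
Qed.

(** * Borel sets and maps *)

Section borel.
Context {X : topologicalType}.
Implicit Types A B : set X.

Lemma borel_setC A : borel_set A -> borel_set (~` A).
Proof. by rewrite -setTD; exact: sigma_algebraCD. Qed.

Lemma borel_set_open A : open A -> borel_set A.
Proof. exact: sub_sigma_algebra. Qed.

Lemma borel_set_closed A : closed A -> borel_set A.
Proof.
move=> cA; rewrite -(setCK A); apply: borel_setC; apply: borel_set_open.
exact: closed_openC.
Qed.

Lemma borel_set0 : borel_set (@set0 X).
Proof. exact: sigma_algebra0. Qed.

Lemma borel_setU A B : borel_set A -> borel_set B -> borel_set (A `|` B).
Proof.
move=> bA bB; rewrite -bigcup2E; apply: sigma_algebra_bigcup.
by case=> [|[|i]] /=; [exact: bA|exact: bB|exact: borel_set0].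
Qed.

Lemma borel_setI A B : borel_set A -> borel_set B -> borel_set (A `&` B).
Proof.
move=> bA bB; rewrite -(setCK (_ `&` _)) setCI; apply: borel_setC.
by apply: borel_setU; exact: borel_setC.
Qed.

Lemma borel_bigcup_countType (I : countType) (P : set I) (F : I -> set X) :
  (forall i, P i -> borel_set (F i)) -> borel_set (\bigcup_(i in P) F i).
Proof.
move=> bF; pose G n := if unpickle n is Some i then
  (if `[< P i >] then F i else set0) else set0.
have -> : \bigcup_(i in P) F i = \bigcup_n G n.
  apply/seteqP; split=> x [i].
    by move=> Pi Fix; exists (pickle i) => //; rewrite /G pickleK asboolT.
  by rewrite /G; case: unpickle => // j _; case: asboolP => // Pj Fjx; exists j.
apply: sigma_algebra_bigcup => n; rewrite /G; case: unpickle => [i|].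
  by case: asboolP => [/bF|_] //; exact: borel_set0.
exact: borel_set0.
Qed.

Lemma borel_bigcap_seq (I : eqType) (s : seq I) (F : I -> set X) :
  (forall i, borel_set (F i)) -> borel_set [set x | forall i, i \in s -> F i x].
Proof.
move=> bF; elim: s => [|i s IH].
  by apply: borel_set_open; rewrite (_ : mkset _ = setT);
    [exact: openT|apply/seteqP; split].
rewrite (_ : mkset _ = F i `&` [set x | forall j, j \in s -> F j x]).
  exact: borel_setI.
apply/seteqP; split=> x /=.
  move=> h; split; first by apply: h; rewrite inE eqxx.
  by move=> j js; apply: h; rewrite inE js orbT.
by move=> [Fi h] j; rewrite inE => /orP[/eqP->//|]; exact: h.
Qed.

Lemma borel_map_open (Y : topologicalType) (f : X -> Y) :
  (forall U, open U -> borel_set (f @^-1` U)) -> borel_map f.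
Proof.
move=> fo; apply: (@smallest_sub _ _ _ [set B | borel_set (f @^-1` B)]); last exact: fo.
split=> [|A bA|A bA] /=; first by rewrite preimage_set0; exact: borel_set0.
  by rewrite setTD preimage_setC; exact: borel_setC.
by rewrite preimage_bigcup; exact: sigma_algebra_bigcup.
Qed.

End borel.

(** Exact agreement with [z] at finitely many coordinates generates a filter, which converges to [z]
    because convergence is checked at each coordinate. *)
Lemma ptws_ptws_nbhs (R : realType) (z : {ptws nat -> {ptws nat -> R}})
    (U : set {ptws nat -> {ptws nat -> R}}) : nbhs z U ->
  exists s : seq (nat * nat), forall z' : nat -> nat -> R,
    (forall p, p \in s -> z' p.1 p.2 = z p.1 p.2) -> U z'.
Proof.
pose V (s : seq (nat * nat)) : set {ptws nat -> {ptws nat -> R}} :=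
  [set z' | forall p, p \in s -> z' p.1 p.2 = z p.1 p.2].
pose F := filter_from setT V.
have FF : Filter F.
  apply: filter_from_filter; first by exists [::].
  move=> s t _ _; exists (s ++ t) => // z' h; split=> p ps; apply: h.
    by rewrite mem_cat ps.
  by rewrite mem_cat ps orbT.
suff Fz : {ptws, F --> z}.
  by move=> /Fz [s _ h]; exists s => z' ?; apply: h.
apply/pointwise_cvgP => m; apply/pointwise_cvgP => j W /nbhs_singleton Wz.
exists [:: (m, j)] => // z' h; rewrite /=; have /= -> // := h (m, j).
by rewrite inE.
Qed.

(* An open set of the product contains, with each point, the set of points
   sharing finitely many of its coordinates; since the coordinates are integers,
   there are countably many such conditions. *)
Lemma borel_map_nat_valued (R : realType) (X : topologicalType)
    (g : X -> nat -> nat -> nat) :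
  (forall m j v, borel_set [set x | g x m j = v]) ->
  @borel_map X {ptws nat -> {ptws nat -> R}} (fun x m j => (g x m j)%:R).
Proof.
move=> bg; apply: borel_map_open => U oU.
pose good : set (seq (nat * nat * nat)) :=
  [set s | forall z : nat -> nat -> R,
    (forall p, p \in s -> z p.1.1 p.1.2 = p.2%:R) -> U z].
rewrite (_ : _ @^-1` _ = \bigcup_(s in good)
    [set x | forall p, p \in s -> g x p.1.1 p.1.2 = p.2]).
  by apply: borel_bigcup_countType => s _; apply: borel_bigcap_seq => p; exact: bg.
apply/seteqP; split=> x /=.
  move=> Ux; have [s h] := ptws_ptws_nbhs (open_nbhs_nbhs (conj oU Ux)).
  exists [seq (p, g x p.1 p.2) | p <- s].
    move=> z hz; apply: h => p ps; apply: (hz (p, g x p.1 p.2)).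
    by apply/mapP; exists p.
  by move=> _ /mapP[p ps ->].
by move=> [s gs hs]; apply: gs => p /hs ->.
Qed.

(** * Embedding into R/l_infinity *)

Section kuratowski_embedding.
Context {T : topologicalType} (Q : nat -> T -> T -> Prop) (C : nat -> set T).

(* As [reach Q n B] grows with [n], this is the least [n] such that [x] reaches
   [C p.1] in [n] steps, truncated at [p.2]. *)
Definition step_distance (x : T) (p : nat * nat) : nat :=
  (\sum_(n < p.2) `[< ~ reach Q n (C p.1) x >])%N.

Lemma step_distance_le x y p n : reach Q n [set y] x ->
  (step_distance x p <= step_distance y p + n)%N.
Proof.
move=> xy; case: p => k N; rewrite /step_distance /=.
(* The sum for [x] is lengthened to [n + N] terms: the first [n] contribute at most [n], and term
   [n + i] for [x] is at most term [i] for [y]. *)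
apply: (@leq_trans (\sum_(i < n + N) `[< ~ reach Q i (C k) x >])%N).
  rewrite -(big_mkord xpredT (fun i => `[< ~ reach Q i (C k) x >] : nat)).
  rewrite -(big_mkord xpredT (fun i => `[< ~ reach Q i (C k) x >] : nat)).
  by rewrite [leqRHS](@big_cat_nat _ _ _ N) //= ?leq_addr// leq_addl.
elim: N => [|N IH].
  rewrite big_ord0 addn0 add0n -[leqRHS]card_ord -sum1_card.
  by apply: leq_sum => i _; exact: leq_b1.
rewrite addnS !big_ord_recr /= addnAC leq_add//.
case: asboolP => //= nx; case: asboolP => //= /contrapT yN; exfalso; apply: nx.
apply: reach_comp; move: xy; rewrite /reach => xy.
by apply: iter_spreadS xy => // _ ->.
Qed.

Hypothesis Qsym : forall i x y, Q i x y -> Q i y x.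
Hypothesis Qclosed : forall i B, closed B -> closed [set x | exists2 b, B b & Q i x b].
Hypothesis Cbase : closed_base C.

(** The points reached from [x] in [N] steps form a closed set missing [y], so some basic
    neighbourhood of [y] misses it too; that neighbourhood separates the two distances as far as the
    truncation allows. *)
Lemma step_distance_unbounded x y N : closed [set x] ->
  (forall n, ~ reach Q n [set y] x) ->
  exists k, step_distance x (k, N) = N /\ step_distance y (k, N) = 0%N.
Proof.
move=> cx nxy; have nyx : ~ reach Q N [set x] y by move/(reach1_sym Qsym); exact: nxy.
have [|k [yCk Ckx]] := Cbase.2 y (~` reach Q N [set x]).
  by apply: open_nbhs_nbhs; split=> //; apply/closed_openC/closed_reach.
exists k; rewrite /step_distance /=; split; last first.
  rewrite big1// => i _; rewrite asboolF//; apply; apply: reach_sub.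
  exact: nbhs_singleton yCk.
rewrite -[RHS]card_ord -sum1_card; apply: eq_bigr => i _; rewrite asboolT// => xCk.
have [|z [Ckz zx]] := @reach_adj _ _ Qsym i (C k) [set x]; first by exists x.
by apply: (Ckx z Ckz); apply: reach_mono (ltnW (ltn_ord i)) _ zx.
Qed.

Lemma reach_ell_infty (R : realType) x y : closed [set x] ->
  (exists n, reach Q n [set y] x) <->
  @R_mod_ell_infty R (fun j => (step_distance x (decode_pair j))%:R)
                     (fun j => (step_distance y (decode_pair j))%:R).
Proof.
move=> cx; split=> [[n xy]|[M [_ bM]]].
  exists n%:R; split=> // r nr j _ /=; apply: le_trans (ltW nr).
  have := step_distance_le (decode_pair j) xy.
  have := step_distance_le (decode_pair j) (reach1_sym Qsym xy).
  rewrite -2!(ler_nat R) !natrD ler_norml => yx' xy'.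
  by apply/andP; split; lra.
apply: contrapT => nxy.
(* Every real above [M] is a bound, in particular [M + 1]; the coordinate coding [(k, N)] will
   violate it. *)
have [N MN] : exists N, M + 1 < N%:R.
  exists (Num.bound `|M + 1|); apply: le_lt_trans (ler_norm _) _.
  exact: archi_boundP.
have nxy' n : ~ reach Q n [set y] x by move=> h; apply: nxy; exists n.
have [k [sx sy]] := step_distance_unbounded N cx nxy'.
have M1 : M < M + 1 by rewrite ltrDl.
have /(_ (pickle (k, N)) I) := bM _ M1.
rewrite /= decode_pairK sx sy subr0 normr_nat leNgt.
by rewrite MN.
Qed.

(** Induction on the truncation: the last summand is the indicator of the complement of a closed
    set. *)
Lemma borel_step_distance p v : borel_set [set x | step_distance x p = v].
Proof.
case: p => k N; rewrite /step_distance /=; elim: N v => [|N IH] v.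
  rewrite (_ : mkset _ = if v == 0%N then setT else set0).
    case: ifP => _; last exact: borel_set0.
    by apply: borel_set_open; exact: openT.
  by apply/seteqP; split=> x /=; rewrite big_ord0; case: v.
pose G x := (\sum_(n < N) `[< ~ reach Q n (C k) x >])%N.
rewrite (_ : mkset _ = (reach Q N (C k) `&` [set x | G x = v]) `|`
   (~` reach Q N (C k) `&` [set x | (G x).+1 = v])).
  have bR : borel_set (reach Q N (C k)).
    by apply: borel_set_closed; apply: closed_reach => //; exact: Cbase.1.
  apply: borel_setU; apply: borel_setI => //; first exact: borel_setC.
  case: v => [|v].
    rewrite (_ : mkset _ = set0); first exact: borel_set0.
    by apply/seteqP; split.
  rewrite (_ : mkset _ = [set x | G x = v]); first exact: IH.
  by apply/seteqP; split=> x /=; [case|move=> ->].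
apply/seteqP; split=> x /=; rewrite big_ord_recr /= -/(G x).
  by case: asboolP => h /= <-; [right|left]; rewrite ?addn1 ?addn0//;
    split=> //; exact: contrapT.
by move=> [[h <-]|[h <-]]; [rewrite asboolF ?addn0//; apply|rewrite asboolT ?addn1].
Qed.

End kuratowski_embedding.

(** * Small compact sets and chains of continua *)

Lemma separable_closed_base (R : realType) (X : pseudoMetricType R) :
  separable X -> exists C : nat -> set X, closed_base C.
Proof.
move=> [D cD dD]; have [[x0 _]|X0] := pselect (exists x0 : X, True); last first.
  exists (fun=> set0); split=> [_|x]; first exact: closed0.
  by exfalso; apply: X0; exists x.
have /pfcard_geP[D0|[e]] := cD.
  have [|x] := dD setT _ openT; first by exists x0.
  by rewrite D0 => -[].
pose C j := closure (ball (e (decode_pair j).1) (decode_pair j).2.+1%:R^-1 : set X).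
exists C; split=> [j|x U xU]; first exact: closed_closure.
have [r r0 rU] := (nbhs_ballP _ _).1 xU.
(* With centre [z] within [d / 2] of [x], the closed ball lies within [d / 2 + d + d] of [x], which
   is below [r]. *)
have [k kr] : exists k, k.+1%:R^-1 < r / 3 :> R.
  have [|k] := @ltr_add_invr R 0 (r / 3); first by rewrite divr_gt0.
  by rewrite add0r; exists k.
pose d : R := k.+1%:R^-1; have d0 : 0 < d by rewrite invr_gt0.
have d20 : 0 < d / 2 by rewrite divr_gt0.
have [|z [xz Dz]] := dD (ball x (d / 2))° _ (open_interior _).
  by exists x; exact: nbhsx_ballx.
have [n _ nz] : (e @` setT) z by exact: (@surj _ _ _ _ e).
have {}xz := interior_subset xz.
exists (pickle (n, k)); rewrite /C decode_pairK /= nz -/d; split.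
  apply/nbhs_ballP; exists (d / 2) => //= w xw; apply: subset_closure.
  by rewrite (splitr d); apply: ball_triangle xw; exact: ball_sym.
move=> w zw; apply: rU.
have [v [zv wv]] := zw (ball w d) (nbhsx_ballx _ _ d0).
apply: le_ball (ball_triangle xz (ball_triangle zv (ball_sym wv))).
by move: kr; rewrite -/d; lra.
Qed.

Lemma diameter_le (R : realType) (X : metricType R) (A : set X) (e : R) :
  (forall x y, A x -> A y -> mdist x y <= e) -> (diameter A <= e%:E)%E.
Proof.
move=> h; apply: ge_ereal_sup => _ [[x y] [/= Ax Ay] <-].
by rewrite lee_fin; exact: h.
Qed.

Lemma mdist_le_diameter (R : realType) (X : metricType R) (A : set X) x y :
  A x -> A y -> ((mdist x y)%:E <= diameter A)%E.
Proof. by move=> Ax Ay; apply: ereal_sup_ubound; exists (x, y). Qed.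

Lemma diameterS (R : realType) (X : metricType R) (A B : set X) :
  A `<=` B -> (diameter A <= diameter B)%E.
Proof.
by move=> AB; apply: le_ereal_sup => _ [p [/AB ? /AB ?] <-]; exists p.
Qed.

Lemma diameter1 (R : realType) (X : metricType R) (x : X) (e : R) :
  0 < e -> (diameter [set x] < e%:E)%E.
Proof.
move=> e0; apply: (@le_lt_trans _ _ 0%E); last by rewrite lte_fin.
by apply: diameter_le => _ _ -> ->; rewrite mdistxx.
Qed.

Lemma compact_closed_base_nbhs (R : realType) (X : metricType R) (C : nat -> set X) (x : X) U :
  locally_compact [set: X] -> closed_base C -> nbhs x U ->
  exists n, [/\ nbhs x (C n), C n `<=` U & compact (C n)].
Proof.
move=> lcX [clC bC] xU; have [V xV [cV _]] := lcX x I.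
have [|n [xC CUV]] := bC x (U `&` V).
  have xV' : nbhs x [set y | [set: X] y -> V y] := xV.
  by apply: filterI => //; apply: filterS xV' => y; exact.
exists n; split=> // [y /CUV[]//|]; apply: subclosed_compact cV _ => //.
by move=> y /CUV[].
Qed.

Lemma small_compact_family (R : realType) (X : metricType R) (C : nat -> set X) (e : R) :
  locally_compact [set: X] -> closed_base C ->
  exists A : nat -> set X,
    (forall i, compact (A i) /\ (diameter (A i) < e%:E)%E) /\
    forall K, K !=set0 -> compact K -> (diameter K < e%:E)%E ->
      exists i, K `<=` A i.
Proof.
move=> lcX bC.
pose U (s : seq nat) := \bigcup_(n in [set` s]) C n.
(* Unsuitable lists yield the empty set, which is compact and has diameter [-oo]. *)
pose A j := let s := odflt [::] (unpickle j) in
  if `[< compact (U s) /\ (diameter (U s) < e%:E)%E >] then U s else set0.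
exists A; split=> [i|K [z Kz] cK dK].
  rewrite /A; case: asboolP => // _; split; first exact: compact0.
  apply: (@le_lt_trans _ _ -oo%E); last exact: ltNyr.
  by apply: ge_ereal_sup => _ [p [[]]].
suff [s [Ks cs ds]] : exists s, [/\ K `<=` U s, compact (U s) & (diameter (U s) < e%:E)%E].
  by exists (pickle s); rewrite /A pickleK /= asboolT.
have dK0 : (0 <= diameter K)%E.
  by apply: le_trans (mdist_le_diameter Kz Kz); rewrite lee_fin mdist_ge0.
have dKfin : diameter K \is a fin_num.
  by rewrite ge0_fin_numE// (lt_trans dK)// ltry.
(* Sets inside [r]-balls centred on [K] enlarge its diameter by at most [2 r], which stays below
   [e]. *)
pose r := (e - fine (diameter K)) / 3.
have de : fine (diameter K) < e by rewrite -lte_fin fineK.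
have r0 : 0 < r by rewrite divr_gt0// subr_gt0.
pose good n := compact (C n) /\ exists2 w, K w & C n `<=` ball w r.
have goodU s : {in s, forall n, good n} -> compact (U s) /\ (diameter (U s) < e%:E)%E.
  move=> gs; split.
    by rewrite /U bigcup_seq big_seq; apply: bigsetU_compact => n /gs[].
  apply: (@le_lt_trans _ _ (r + fine (diameter K) + r)%:E); last first.
    by rewrite lte_fin /r; lra.
  apply: diameter_le => x y [n /= /gs[_ [w Kw /[apply]]]] wx.
  move=> [m /= /gs[_ [v Kv /[apply]]]] vy.
  move: wx vy; rewrite !ballEmdist /= => wx vy.
  have wv : mdist w v <= fine (diameter K).
    by rewrite -lee_fin fineK//; exact: mdist_le_diameter.
  have := metric_triangle x w y; have := metric_triangle w v y.
  by rewrite (metric_sym x w); lra.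
suff [s gs Ks] : exists2 s, {in s, forall n, good n} & K `<=` U s.
  by exists s; have [] := goodU s gs.
apply: contrapT => noS.
(* Without a finite cover the remainders of [K] form a proper filter; a good base member around a
   cluster point contradicts this. *)
pose F := filter_from [set s : seq nat | {in s, forall n, good n}] (fun s => K `\` U s).
have PF : ProperFilter F.
  apply: filter_from_proper; first apply: filter_from_filter.
  - by exists [::].
  - move=> s t gs gt; exists (s ++ t).
      by move=> n; rewrite mem_cat => /orP[/gs|/gt].
    move=> x [Kx nx]; split; split=> // -[n ns Cx]; apply: nx; exists n => //=.
      by rewrite mem_cat ns.
    by rewrite mem_cat ns orbT.
  move=> s gs; apply/set0P/eqP => Ks; apply: noS; exists s => //.
  by rewrite -setD_eq0.
have [|p [Kp clp]] := cK F _; first by exists [::] => // x [].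
have [n [pC Cr cC]] := compact_closed_base_nbhs lcX bC (nbhsx_ballx p r r0).
have [|x [[_ nx] Cx]] := clp (K `\` U [:: n]) (C n) _ pC.
  exists [:: n] => // m; rewrite inE => /eqP ->; split=> //.
  by exists p.
by apply: nx; exists n => //=; rewrite inE.
Qed.

Section small_chain.
Context {R : realType} {X : metricType R}.
Implicit Types (e : R) (x y : X).

Definition small_chain e x y :=
  exists (n : nat) (K : nat -> set X),
    [/\ forall i, (i <= n)%N -> continuum (K i) /\ (diameter (K i) < e%:E)%E,
        K 0%N x, K n y &
        forall i, (i < n)%N -> K i `&` K i.+1 !=set0].

Lemma small_chainS e e' x y : e <= e' -> small_chain e x y -> small_chain e' x y.
Proof.
move=> ee' [n [K [sK Kx Ky KK]]]; exists n, K; split=> // i /sK[cK dK].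
by split=> //; apply: lt_le_trans dK _; rewrite lee_fin.
Qed.

Lemma small_chain_refl e x : 0 < e -> small_chain e x x.
Proof.
move=> e0; exists 0%N, (fun=> [set x]); split=> // i _; split.
  by split; [exists x|exact: compact_set1|exact: connected1].
exact: diameter1.
Qed.

Lemma small_chain_cons e (L : set X) x y z :
  continuum L -> (diameter L < e%:E)%E -> L x -> L y ->
  small_chain e y z -> small_chain e x z.
Proof.
move=> cL dL Lx Ly [n [K [sK Ky Kz KK]]].
exists n.+1, (fun i => if i is j.+1 then K j else L).
split=> // [[|i] //|[|i] //=]; [exact: sK| |exact: KK].
by exists y.
Qed.

Context (e : R) (A : nat -> set X).
Hypothesis e0 : 0 < e.
Hypothesis Asmall : forall i, compact (A i) /\ (diameter (A i) < e%:E)%E.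
Hypothesis Acover : forall K, K !=set0 -> compact K -> (diameter K < e%:E)%E ->
  exists i, K `<=` A i.

Let Q i := connected_component (A i).

(** The component is itself a continuum no larger than [A i], so it serves as the first link. *)
Lemma small_chain_component i x y z : Q i x y -> small_chain e y z -> small_chain e x z.
Proof.
move=> Qxy; have Ax := connected_component_sub (connected_component_sym Qxy).
have clA : closed (A i) by apply: compact_closed (Asmall i).1; exact: metric_hausdorff.
apply: (small_chain_cons (L := Q i x)) => //.
- split; [by exists y| |exact: component_connected].
  apply: subclosed_compact (Asmall i).1 _; first exact: component_closed.
  exact: connected_component_sub.
- apply: le_lt_trans (Asmall i).2; apply: diameterS.
  exact: connected_component_sub.
- exact: connected_component_refl.
Qed.

Lemma small_chain_reach x y : small_chain e x y <-> exists n, reach Q n [set y] x.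
Proof.
split=> [[n [K [sK Kx Ky KK]]]|[n]]; last first.
  rewrite /reach; elim: {1}n x => [x ->|k IH x /= [/IH//|[i _ [b /IH yb xb]]]].
    exact: small_chain_refl.
  exact: (small_chain_component xb yb).
(* Induction along the chain from the end at [y]: each link lies in one component of some [A a]. *)
suff H i : (i <= n)%N -> forall z, K (n - i)%N z -> exists N, reach Q N [set y] z.
  by apply: (H n) => //; rewrite subnn.
have step j z w N : (j <= n)%N -> K j z -> K j w -> reach Q N [set y] w ->
    exists N, reach Q N [set y] z.
  move=> /sK[[K0 cK coK] dK] Kz Kw Nw.
  have [a KA] := Acover K0 cK dK.
  exists (a.+1 + N)%N; apply: reach_step Nw.
  exact: (connected_component_max Kz KA coK).
elim: i => [|i IH] ni z Kz.
  rewrite subn0 in Kz; apply: (step n z y 0%N) => //.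
have [|w [Kw Kw']] := KK (n - i.+1)%N; first by lia.
rewrite subnSK// in Kw'.
have [N Nw] := IH (ltnW ni) w Kw'.
exact: (step _ _ _ _ (leq_subr _ _) Kz Kw Nw).
Qed.

End small_chain.

Theorem theorem42 (R : realType) (X : metricType R)
    (polishX : polish R X) (lcX : locally_compact [set: X]) :
  @borel_reducible X {ptws nat -> {ptws nat -> R}}
    (@chain_continuum_connected R X)
    (@rel_power {ptws nat -> R} (@R_mod_ell_infty R)).
Proof.
have [C bC] := separable_closed_base polishX.1.
have eps0 m : 0 < m.+1%:R^-1 :> R by rewrite invr_gt0.
have /choice[A AP] := fun m => small_compact_family (m.+1%:R^-1) lcX bC.
pose Q m i := connected_component (A m i).
have Qsym m i x y : Q m i x y -> Q m i y x by exact: connected_component_sym.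
have X2 : hausdorff_space X by exact: metric_hausdorff.
have Qclosed m i (B : set X) : closed B ->
    closed [set x | exists2 b, B b & Q m i x b].
  have [cA _] := (AP m).1 i.
  by apply: (@closed_component_saturation R) => //;
    [exact: pseudometric_normal|exact: compact_closed].
exists (fun x m j => (step_distance (Q m) C x (decode_pair j))%:R).
  apply: borel_map_nat_valued => m j v.
  by apply: borel_step_distance bC _ _; exact: Qclosed.
move=> x y; rewrite /rel_power.
have cx : closed [set x] by exact: accessible_closed_set1 (hausdorff_accessible X2) _.
split=> [xy m|xy e e_gt0].
  apply/(reach_ell_infty (Qsym m) (Qclosed m) bC R y cx).
  apply/(small_chain_reach (eps0 m) (AP m).1 (AP m).2); exact: xy.
(* Some scale 1/(m+1) lies below [e], and a chain at a smaller scale is also one at scale [e]. *)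
have [m] := @ltr_add_invr R 0 e e_gt0; rewrite add0r => me.
apply: (small_chainS (ltW me)).
apply/(small_chain_reach (eps0 m) (AP m).1 (AP m).2).
exact/(reach_ell_infty (Qsym m) (Qclosed m) bC R y cx).
Qed.
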